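(* Let $\lambda$ be a positive integer, let $(G,+)$ be an additive abelian group with $|G|=2\lambda+1$, and let $(A,B)$ be a skew Hadamard difference family with two blocks in $G$. Let $Q$ be the Laplacian matrix of the directed graph $\mathcal{SZ}(G,A,B)$ and $\mathcal{K}$ its critical group. Then $\mathcal{K}\cong\left(\mathbb{Z}/(\lambda+1)\mathbb{Z}\right)^{2\lambda+1}\oplus\left(\mathbb{Z}/(4\lambda+3)\mathbb{Z}\right)^{2\lambda}$. Moreover, for a prime $\mathfrak{p}$, letting $\mathrm{rk}_{\mathfrak{p}}(Q)$ denote the rank of $Q$ over $\mathbb{F}_{\mathfrak{p}}$: if $\mathfrak{p}\mid \lambda+1$ then $\mathrm{rk}_{\mathfrak{p}}(Q)=2\lambda+1$, and if $\mathfrak{p}\mid 4\lambda+3$ then $\mathrm{rk}_{\mathfrak{p}}(Q)=2\lambda+2$.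
   Context: A skew Hadamard difference family with two blocks in an abelian group $G$ of order $2\lambda+1$ is a pair $(A,B)$ of subsets of $G$ such that for each $X\in\{A,B\}$: $X\cap(-X)=\emptyset$ and $X\cup(-X)=G\setminus\{0\}$ (so $|A|=|B|=\lambda$), and for every $g\in G\setminus\{0\}$ the number of pairs $(x,y)\in A\times A$ with $x-y=g$ plus the number of pairs $(x,y)\in B\times B$ with $x-y=g$ equals $\lambda-1$. $\mathcal{SZ}(G,A,B)$ is the directed graph with vertex set $V=\{v_0\}\cup\{a_g: g\in G\}\cup\{b_g:g\in G\}$ (all distinct, $4\lambda+3$ vertices) and the following arcs: $v_0\to a_x$ for all $x\in G$; $a_g\to a_{g+z}$ for $z\in A$; $a_g\to b_{g+z}$ for $z\in B\cup\{0\}$; $b_g\to v_0$; $b_g\to b_{g+z}$ for $z\in -A$; $b_g\to a_{g+z}$ for $z\in B$ (for all $g\in G$). (This is a doubly-regular tournament with parameters $(4\lambda+3,2\lambda+1,\lambda)$.) For a finite directed graph with vertex set $V$, the Laplacian matrix is $Q=\Delta-M$, where $M$ is the adjacency matrix ($M_{v,w}=1$ if there is an arc $v\to w$, else $0$) and $\Delta$ is the diagonal matrix of out-degrees. The critical group is the torsion subgroup of the cokernel of the map $\mathbb{Z}^V\to\mathbb{Z}^V$ given by $Q$. *)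

(* Defs.v *)
From HB Require Import structures.
From mathcomp Require Import all_boot all_order all_algebra.
From mathcomp Require Import boolp.

Set Implicit Arguments.
Unset Strict Implicit.
Unset Printing Implicit Defensive.

Import GRing.Theory.
Local Open Scope ring_scope.

(* Membership in the image of a homomorphism and torsion are turned into
   boolean predicates with the classical `[< _ >], as required by the library
   quotient {quot _} and by subtypes. *)

Section Cokernel.
Variables (U V : zmodType) (f : {additive U -> V}).

Definition image_pred : {pred V} := fun y => `[< exists x, y = f x >].

Fact image_pred_zmod_closed : zmod_closed image_pred.
Proof.
split=> [|_ _ /asboolP[x ->] /asboolP[y ->]]; apply/asboolP.
  by exists 0; rewrite raddf0.
by exists (x - y); rewrite raddfB.
Qed.

HB.instance Definition _ :=
  GRing.isZmodClosed.Build V image_pred image_pred_zmod_closed.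

Definition coker : zmodType := Quotient.quot image_pred.

End Cokernel.

Section Torsion.
Variable M : zmodType.

Definition torsion_pred : {pred M} :=
  fun x => `[< exists2 n : nat, (0 < n)%N & x *+ n = 0 >].

Fact torsion_pred_zmod_closed : zmod_closed torsion_pred.
Proof.
split=> [|x y /asboolP[m m_gt0 xm] /asboolP[n n_gt0 yn]]; apply/asboolP.
  by exists 1%N.
exists (m * n)%N; first by rewrite muln_gt0 m_gt0.
by rewrite mulrnBl mulrnA xm mul0rn mulnC mulrnA yn mul0rn subr0.
Qed.

HB.instance Definition _ :=
  GRing.isZmodClosed.Build M torsion_pred torsion_pred_zmod_closed.

Record torsion := Torsion {
  torsion_val :> M;
  torsion_valP : torsion_val \in torsion_pred }.

HB.instance Definition _ := [isSub for torsion_val].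
HB.instance Definition _ := [Choice of torsion by <:].
HB.instance Definition _ := [SubChoice_isSubZmodule of torsion by <:].

End Torsion.

Definition zmod_isomorphic (M N : zmodType) : Prop :=
  exists f : {additive M -> N}, bijective f.

(* A directed graph on V is given by its arc relation; rows and columns of its
   matrices are indexed by V through the enumeration enum_val. *)
Section Digraph.
Variables (V : finType) (arc : rel V).

Definition outdegree (v : V) : nat := #|[set w | arc v w]|.

Definition adjacency_mx : 'M[int]_#|V| :=
  \matrix_(i, j) (arc (enum_val i) (enum_val j) : nat)%:Z.

Definition outdegree_mx : 'M[int]_#|V| :=
  diag_mx (\row_i (outdegree (enum_val i))%:Z).

Definition laplacian : 'M[int]_#|V| := outdegree_mx - adjacency_mx.

Definition laplacian_map : {additive 'cV[int]_#|V| -> 'cV[int]_#|V|} :=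
  mulmx laplacian.

Definition critical_group : zmodType := torsion (coker laplacian_map).

End Digraph.

Definition rank_mod (p m n : nat) (Q : 'M[int]_(m, n)) : nat :=
  \rank (map_mx (intr : int -> 'F_p) Q).

Section SkewHadamard.
Variable G : finZmodType.

Definition neg_set (X : {set G}) : {set G} := [set - x | x in X].

Definition skew_set (X : {set G}) : Prop :=
  X :&: neg_set X = set0 /\ X :|: neg_set X = [set~ 0].

Definition diff_count (X : {set G}) (g : G) : nat :=
  #|[set xy in setX X X | xy.1 - xy.2 == g]|.

Definition skew_hadamard_family (lambda : nat) (A B : {set G}) : Prop :=
  [/\ #|G| = (2 * lambda + 1)%N, skew_set A, skew_set B &
      forall g : G, g != 0 ->
        (diff_count A g + diff_count B g = lambda - 1)%N].

(* None is v_0, Some (inl g) is a_g and Some (inr g) is b_g. *)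
Definition SZ_vertex : finType := option (G + G).

Definition SZ_arc (A B : {set G}) : rel SZ_vertex := fun v w =>
  match v, w with
  | None, Some (inl _) => true
  | Some (inl g), Some (inl h) => h \in [set g + z | z in A]
  | Some (inl g), Some (inr h) => h \in [set g + z | z in B :|: [set 0]]
  | Some (inr _), None => true
  | Some (inr g), Some (inr h) => h \in [set g + z | z in neg_set A]
  | Some (inr g), Some (inl h) => h \in [set g + z | z in B]
  | _, _ => false
  end.

End SkewHadamard.

(* Main.v *)
(* In block form over {v_0}, {a_g}, {b_g} the Laplacian Q satisfies, with
   n = 4 lambda + 3 and J the all-ones matrix, Q J = J Q = 0, Q + Q^T = n - J
   and Q Q^T = (lambda + 1) (n - J); hence Q^2 = n Q - (lambda + 1) (n - J).
   - Modulo lambda + 1 this reads Q^2 = - Q, so Q (-1) Q = Q; for a prime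
     p | lambda + 1, Q Q^T = 0 and Q + Q^T = -(1 + J) force the p-rank to be
     (#|V| - 1) / 2.
   - Modulo n it reads Q^2 = (lambda + 1) J. There are explicit X and Y, with
     Y J = 0 modulo n, such that Q X + Y Q = 1 modulo n. Hence Q X Q = Q modulo
     n, and for a prime p | n the p-rank is (#|V| + 1) / 2. This is the only
     step that uses more than the double regularity of the tournament.
   Let d_i be the invariant factors of Q. If m is lambda + 1 or n, then
   Q X Q = Q modulo m means that each prime power exactly dividing m either
   divides d_i or is coprime to it, and the p-ranks tell which. As
   Q Q^T = (lambda + 1) (n - J) also gives d_i | (lambda + 1) n, except for the
   last one, which vanishes, the d_i are determined. *)
Require Import Defs.
From HB Require Import structures.
From mathcomp Require Import all_boot all_order all_algebra.
From mathcomp Require Import boolp.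
From mathcomp Require Import zify ring.
Set Implicit Arguments.
Unset Strict Implicit.
Unset Printing Implicit Defensive.
Import Order.TTheory GRing.Theory Num.Theory.
Local Open Scope ring_scope.

(** * Torsion of a cokernel *)

Section TorsionCokernel.
Local Open Scope quotient_scope.

(** A first isomorphism theorem restricted to torsion. The last two hypotheses concern only elements
    with a positive multiple in the image of [f]: there the kernel of [g] is that image, and already
    there [g] is onto. *)
Lemma torsion_coker_iso (U V W : zmodType) (f : {additive U -> V})
    (g : {additive V -> W}) :
    (forall u, g (f u) = 0) ->
    (forall x n u, (0 < n)%N -> x *+ n = f u -> g x = 0 ->
       exists v, x = f v) ->
    (forall w, exists x n u, [/\ g x = w, (0 < n)%N & x *+ n = f u]) ->
  zmod_isomorphic (torsion (coker f)) W.
Proof.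
move=> gf0 injg surjg.
have eqC x y : reflect (exists u, x - y = f u)
    (\pi_(coker f) x == \pi_(coker f) y).
  by rewrite -Quotient.idealrBE; apply: asboolP.
have piMn x n : \pi_(coker f) (x *+ n) = (\pi_(coker f) x) *+ n.
  exact: raddfMn.
have pi0 : \pi_(coker f) 0 = 0 by exact: raddf0.
(* Since [g] kills the image of [f], its value does not depend on the representative. *)
have h_pi x : g (repr (\pi_(coker f) x)) = g x.
  have /eqC[u eu] : \pi_(coker f) (repr (\pi_(coker f) x)) == \pi_(coker f) x.
    by rewrite reprK.
  by apply/eqP; rewrite -subr_eq0 -raddfB eu gf0.
pose h (t : torsion (coker f)) : W := g (repr (torsion_val t)).
have h_additive : zmod_morphism h.
  move=> [s sP] [t tP]; rewrite /h /=.
  by rewrite -{1}[s]reprK -{1}[t]reprK -raddfB h_pi raddfB.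
pose hA : {additive torsion (coker f) -> W} :=
  HB.pack h (GRing.isZmodMorphism.Build _ _ h h_additive).
exists hA.
have h_inj : injective hA.
  apply: raddf_inj => -[t tP] /= ht0.
  apply: val_inj => /=.
  move: (tP) => /asboolP[n n_gt0 tn].
  have /eqC[u] : \pi_(coker f) (repr t *+ n) == \pi_(coker f) 0.
    by rewrite piMn reprK tn pi0.
  rewrite subr0 => eu; have [v ev] := injg _ _ _ n_gt0 eu ht0.
  rewrite -[t]reprK -pi0.
  by apply/eqP/eqC; exists v; rewrite subr0.
have h_surj w : exists t, hA t = w.
  have [x [n [u [gx n_gt0 xn]]]] := surjg w.
  have tP : \pi_(coker f) x \in @torsion_pred (coker f).
    apply/asboolP; exists n => //; rewrite -piMn -pi0.
    by apply/eqP/eqC; exists u; rewrite subr0.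
  by exists (Torsion tP); rewrite /hA /= /h /= h_pi.
(* [bijective] asks for an inverse function; it is obtained by choosing preimages. *)
pose k w := sval (cid (h_surj w)).
have kK : cancel k hA by move=> w; rewrite /k; case: cid.
by exists k => // t; apply: h_inj; rewrite kK.
Qed.

End TorsionCokernel.

(** * Smith normal form *)

(** This is literally the matrix in [int_Smith_normal_form], so the two are convertible. A short [d]
    is padded by the default value 0, which every integer divides. *)
Definition smith_mx N (d : seq int) : 'M[int]_N :=
  \matrix_(i, j) (d`_i *+ (i == j :> nat)).

Lemma smith_dvd_leq (d : seq int) i j :
  sorted dvdz d -> (i <= j)%N -> (d`_i %| d`_j)%Z.
Proof.
move=> sd le_ij; have [ltj|gej] := ltnP j (size d); last first.
  by rewrite [d`_j]nth_default.
apply: (sorted_leq_nth _ _ _ sd) => //.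
- by move=> ? ? ?; apply: dvdz_trans.
- exact: dvdzz.
- exact: (leq_ltn_trans le_ij ltj : i < size d)%N.
Qed.

Lemma smith_mul_mx N m (d : seq int) (B : 'M[int]_(N, m)) i j :
  (smith_mx N d *m B) i j = d`_i * B i j.
Proof.
rewrite mxE (bigD1 i) //= mxE eqxx mulr1n big1 ?addr0 // => k ki.
by rewrite mxE eq_sym (negPf ki : (_ == _ :> nat) = false) mul0r.
Qed.

Lemma mul_smith_mx N m (d : seq int) (B : 'M[int]_(m, N)) i j :
  (B *m smith_mx N d) i j = B i j * d`_j.
Proof.
rewrite mxE (bigD1 j) //= mxE eqxx mulr1n big1 ?addr0 // => k kj.
by rewrite mxE (negPf kj : (_ == _ :> nat) = false) mulr0.
Qed.

(** The bound on [a] matters: ['Z_0] and ['Z_1] are both the ring with two elements. *)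
Lemma Zp_intr_eq0 (a : nat) (z : int) :
  (1 < a)%N -> (z%:~R == 0 :> 'Z_a) = (a %| z)%Z.
Proof.
move=> a_gt1; have natE n : (n%:R == 0 :> 'Z_a) = (a %| n)%N.
  by rewrite -val_eqE /= val_Zp_nat.
case: z => n; first by rewrite -pmulrn natE.
by rewrite NegzE rmorphN /= oppr_eq0 -pmulrn natE dvdzE abszN.
Qed.

(** The last hypothesis says, up to sign, that d_i is 1, [a], [b] or [a * b]; phrased by
    divisibility, it ignores signs and splits the two moduli. The isomorphism reads the coordinates
    of [invmx L *m x] from [r] on modulo [a] and from [s] on modulo [b]. The last coordinate carries
    the free part and is left out. *)
Lemma torsion_coker_smith (N p q r s a b : nat) (Q L R : 'M[int]_N)
    (d : seq int) :
    (1 < a)%N -> (1 < b)%N -> coprime a b ->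
    (r + p).+1 = N -> (s + q).+1 = N ->
    L \in unitmx -> R \in unitmx ->
    Q = L *m smith_mx N d *m R ->
    d`_N.-1 = 0 ->
    (forall (i : nat) (y : int), (i < N.-1)%N ->
       (d`_i %| y)%Z =
         ((r <= i)%N ==> (a %| y)%Z) && ((s <= i)%N ==> (b %| y)%Z)) ->
  zmod_isomorphic
    (torsion (coker (mulmx Q : {additive 'cV[int]_N -> 'cV[int]_N})))
    ('rV['Z_a]_p * 'rV['Z_b]_q)%type.
Proof.
move=> a_gt1 b_gt1 cop_ab rpN sqN uL uR defQ dlast dvd_d.
have lt_r (j : 'I_p) : (r + j < N)%N by have := ltn_ord j; lia.
have lt_s (j : 'I_q) : (s + j < N)%N by have := ltn_ord j; lia.
pose g (x : 'cV[int]_N) : ('rV['Z_a]_p * 'rV['Z_b]_q)%type :=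
  (\row_j ((invmx L *m x) (Ordinal (lt_r j)) 0)%:~R,
   \row_j ((invmx L *m x) (Ordinal (lt_s j)) 0)%:~R).
have g_additive : zmod_morphism g.
  move=> x y; rewrite /g mulmxBr.
  by congr pair; apply/rowP => j; rewrite !mxE rmorphB.
pose gA : {additive 'cV[int]_N -> ('rV['Z_a]_p * 'rV['Z_b]_q)%type} :=
  HB.pack g (GRing.isZmodMorphism.Build _ _ g g_additive).
have g_eq0 x : g x = 0 <->
    (forall i : 'I_N, (i < N.-1)%N -> (d`_i %| (invmx L *m x)%R i ord0)%Z).
  split=> [[/rowP xa /rowP xb] i lti | dvx].
    rewrite dvd_d //; apply/andP; split; apply/implyP => le_i.
      have lt_ip : (i - r < p)%N by lia.
      have ei : Ordinal (lt_r (Ordinal lt_ip)) = i.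
        by apply: val_inj => /=; lia.
      have := xa (Ordinal lt_ip); rewrite mxE [RHS]mxE ei => /eqP.
      by rewrite Zp_intr_eq0.
    have lt_iq : (i - s < q)%N by lia.
    have ei : Ordinal (lt_s (Ordinal lt_iq)) = i by apply: val_inj => /=; lia.
    have := xb (Ordinal lt_iq); rewrite mxE [RHS]mxE ei => /eqP.
    by rewrite Zp_intr_eq0.
  rewrite /g; congr pair; apply/rowP => j; rewrite mxE [RHS]mxE; apply/eqP.
    have := dvx (Ordinal (lt_r j)); have ltj := ltn_ord j.
    rewrite dvd_d /=; last by lia.
    by rewrite leq_addr Zp_intr_eq0 //; case/(_ _)/andP => //; lia.
  have := dvx (Ordinal (lt_s j)); have ltj := ltn_ord j.
  rewrite dvd_d /=; last by lia.
  by rewrite leq_addr Zp_intr_eq0 //; case/(_ _)/andP => //; lia.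
have uL' : invmx L \in unitmx by rewrite unitmx_inv.
have LQ (u : 'cV_N) : invmx L *m (Q *m u) = smith_mx N d *m (R *m u).
  by rewrite defQ -!mulmxA mulKmx.
have last_ord (i : 'I_N) : (N.-1 <= i)%N -> d`_i = 0.
  by move=> lei; rewrite (_ : nat_of_ord i = N.-1) //; have := ltn_ord i; lia.
apply: (@torsion_coker_iso _ _ _ _ gA).
- by move=> u; apply/g_eq0 => i _; rewrite LQ smith_mul_mx dvdz_mulr.
- move=> x n u n_gt0 xn /g_eq0 dvx.
  pose v : 'cV_N := \col_i ((invmx L *m x)%R i ord0 %/ d`_i)%Z.
  exists (invmx R *m v); apply: (can_inj (mulKmx uL')).
  rewrite LQ mulKVmx //; apply/colP => i; rewrite smith_mul_mx [v i 0]mxE.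
  have [lti|/last_ord d0] := ltnP i N.-1; first by rewrite mulrC divzK ?dvx.
  rewrite d0 mul0r; apply/eqP.
  (* In the last coordinate the Smith form vanishes, so [n] times the entry is zero, and [n] is
     positive. *)
  have /colP/(_ i)/eqP : invmx L *m (x *+ n) = smith_mx N d *m (R *m u).
    by rewrite xn LQ.
  by rewrite smith_mul_mx d0 mul0r raddfMn mulmxnE mulrn_eq0 eqn0Ngt n_gt0.
- move=> [ua ub].
  (* Lifts the entries of [w] to integers, with 0 out of range. For [i < r] the truncated [i - r]
     yields an arbitrary residue, which [g] never reads; likewise for [s]. *)
  pose c m t (w : 'rV['Z_m]_t) (i : nat) : int :=
    if insub i is Some j then (w 0 j : nat)%:Z else 0.
  have cE m t (w : 'rV['Z_m]_t) (j : 'I_t) : (1 < m)%N ->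
      (c m t w j)%:~R = w 0 j.
    by move=> m_gt1; rewrite /c valK -pmulrn natr_Zp.
  pose y : 'cV[int]_N := \col_i if (i < N.-1)%N then
    zchinese a b (c _ _ ua (i - r)%N) (c _ _ ub (i - s)%N) else 0.
  have yE m t (w : 'rV['Z_m]_t) (j : 'I_t) z : (1 < m)%N ->
      (z = c _ _ w j %[mod m])%Z -> z%:~R = w 0 j.
    move=> m_gt1 /eqP; rewrite eqz_mod_dvd -(cE _ _ w) // => zm.
    by apply/eqP; rewrite -subr_eq0 -rmorphB Zp_intr_eq0.
  pose z : 'cV[int]_N := \col_i ((y i ord0 * (a * b)%N) %/ d`_i)%Z.
  (* Every d_i before the last divides [a * b], and the last entry of [y] is 0, so [a * b] makes
     this element a boundary. *)
  exists (L *m y), (a * b)%N, (invmx R *m z).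
  split; last 2 first.
  + by rewrite muln_gt0; lia.
  + apply: (can_inj (mulKmx uL')); rewrite LQ mulKVmx // raddfMn /= mulKmx //.
    apply/colP => i; rewrite smith_mul_mx mulmxnE [z i 0]mxE.
    have [lti|lei] := ltnP i N.-1; last first.
      by rewrite last_ord // mul0r mxE ltnNge lei mul0rn.
    rewrite mulrC divzK; first by rewrite -[LHS]mulr_natr natz.
    rewrite dvd_d // PoszM; apply/andP; split; apply/implyP => _.
      exact/dvdz_mull/dvdz_mulr.
    exact/dvdz_mull/dvdz_mull.
  rewrite /gA /= /g mulKmx //; congr pair; apply/rowP => j; rewrite !mxE /=.
    apply: yE => //=; rewrite ifT; last by have := ltn_ord j; lia.
    by rewrite addKn zchinese_modl.
  apply: yE => //=; rewrite ifT; last by have := ltn_ord j; lia.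
  by rewrite addKn zchinese_modr.
Qed.

(** The rank modulo [p] counts the d_i prime to [p], and the divisibility chain puts these first. *)
Lemma rank_mod_smith (p N : nat) (L R : 'M[int]_N) (d : seq int) i :
    prime p -> L \in unitmx -> R \in unitmx -> sorted dvdz d -> (i < N)%N ->
  (p %| d`_i)%Z = (rank_mod p (L *m smith_mx N d *m R) <= i)%N.
Proof.
move=> p_pr uL uR sd ltiN.
pose f : {rmorphism int -> 'F_p} := intr.
have unit_f (A : 'M[int]_N) : A \in unitmx -> map_mx f A \in unitmx.
  by rewrite !unitmxE det_map_mx; apply: rmorph_unit.
have -> : rank_mod p (L *m smith_mx N d *m R) = \rank (map_mx f (smith_mx N d)).
  rewrite /rank_mod !map_mxM mxrankMfree; last first.
    by rewrite row_free_unit unit_f.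
  by rewrite -mxrank_tr trmx_mul mxrankMfree ?mxrank_tr //
     row_free_unit unitmx_tr unit_f.
have dvd_p z : (p %| z)%Z = (f z == 0) by rewrite (dvdz_pcharf (pchar_Fp p_pr)).
apply/idP/idP => [pdi | ].
  (* From index [i] on all rows vanish modulo [p], so only the first [i] rows survive. *)
  have -> : map_mx f (smith_mx N d) = pid_mx i *m map_mx f (smith_mx N d).
    apply/matrixP => j k; rewrite mxE [RHS]mxE (bigD1 j) //= big1 => [|l lj].
      rewrite addr0 !mxE eqxx /=; case: ltnP => [|le_ij].
        by rewrite mul1r.
      rewrite mul0r; have := smith_dvd_leq sd le_ij.
      move/(dvdz_trans pdi); rewrite dvd_p => /eqP fd.
      by rewrite rmorphMn /= fd mul0rn.
    by rewrite mxE eq_sym (negPf lj : (_ == _ :> nat) = false) mul0r.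
  by rewrite (leq_trans (mxrankM_maxl _ _)) // rank_pid_mx // ltnW.
apply: contraLR; rewrite -ltnNge => npdi.
(* [E] inverts the entries of index at most [i], all nonzero modulo [p]; the product is
   [pid_mx i.+1]. *)
pose E : 'M['F_p]_N := \matrix_(j, k) ((f d`_j)^-1 *+ ((j == k) && (j <= i)%N)).
have <- : \rank (map_mx f (smith_mx N d) *m E) = i.+1.
  rewrite -(@rank_pid_mx 'F_p N N i.+1) //; congr (\rank _).
  apply/matrixP => j k; rewrite mxE (bigD1 j) //= big1 => [|l lj].
    rewrite addr0 !mxE eqxx mulr1n ltnS; have [->|jk] := eqVneq j k.
      rewrite eqxx /=; case: leqP => [le_ki|]; last by rewrite mulr0.
      rewrite mulr1n mulfV // -dvd_p; apply: contra npdi => pdk.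
      exact: dvdz_trans pdk (smith_dvd_leq sd le_ki).
    by rewrite (negPf jk : (_ == _ :> nat) = false) mulr0.
  rewrite [map_mx _ _ _ _]mxE mxE eq_sym.
  by rewrite (negPf lj : (_ == _ :> nat) = false) mulr0n rmorph0 mul0r.
exact: mxrankM_maxl.
Qed.

Lemma coprimez_prime (m : nat) (z : int) :
    (0 < m)%N ->
    (forall p, prime p -> (p %| m)%N -> ~~ (p %| z)%Z) ->
  coprimez z m.
Proof.
move=> m_gt0 ndvd; rewrite /coprimez; apply/negPn/negP => g1.
have m_neq0 : m%:Z != 0 by rewrite eqz_nat -lt0n.
have [p p_pr] : exists2 p, prime p & (p %| gcdz z m)%Z.
  exists (pdiv `|gcdz z m|); last by rewrite dvdzE pdiv_dvd.
  apply: pdiv_prime; rewrite ltn_neqAle eq_sym; apply/andP; split.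
    by apply: contra g1.
  by rewrite absz_gt0 gcdz_eq0 negb_and m_neq0 orbT.
by rewrite dvdz_gcd => /andP[pz pm]; have /negP := ndvd p p_pr pm.
Qed.

(** On the diagonal of the Smith form regularity reads [d_i * (x * d_i - 1) = m * w]. As the rank is
    the same for all primes of [m], either all of them divide d_i or none does. In the first case
    [x * d_i - 1] is coprime to [m], so [m] divides d_i. *)
Lemma smith_regular_mod (m N r : nat) (L R X W : 'M[int]_N) (d : seq int) i :
    (0 < m)%N -> L \in unitmx -> R \in unitmx -> sorted dvdz d ->
    let Q := L *m smith_mx N d *m R in
    Q *m X *m Q = Q + m%:Z *: W ->
    (forall p, prime p -> (p %| m)%N -> rank_mod p Q = r) -> (i < N)%N ->
  if (r <= i)%N then (m %| d`_i)%Z else coprimez d`_i m.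
Proof.
move=> m_gt0 uL uR sd Q regQ rkQ ltiN.
have dvd_p p : prime p -> (p %| m)%N -> (p %| d`_i)%Z = (r <= i)%N.
  by move=> p_pr pm; rewrite (rank_mod_smith p_pr uL uR) // rkQ.
case: ifP => ri; last first.
  by apply: coprimez_prime => // p p_pr pm; rewrite dvd_p ?ri.
pose o := Ordinal ltiN.
have eqD : smith_mx N d *m (R *m X *m L) *m smith_mx N d =
    smith_mx N d + m%:Z *: (invmx L *m W *m invmx R).
  apply: (can_inj (mulKmx uL)); apply: (can_inj (mulmxK uR)).
  rewrite mulmxDr mulmxDl -!scalemxAr -scalemxAl !mulmxA mulmxV // mul1mx.
  by rewrite mulmxKV // -regQ /Q !mulmxA.
pose x := (R *m X *m L) o o; pose w := (invmx L *m W *m invmx R) o o.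
have eqd : d`_i * (x * d`_i - 1) = m%:Z * w.
  move/matrixP/(_ o o): eqD; rewrite mul_smith_mx smith_mul_mx [RHS]mxE.
  rewrite [(smith_mx N d) o o]mxE eqxx mulr1n [X in _ + X]mxE -/x -/w /= => e.
  by rewrite mulrBr mulr1 mulrA e addrAC subrr add0r.
have cop : coprimez m (x * d`_i - 1).
  rewrite coprimez_sym; apply: coprimez_prime => // p p_pr pm.
  rewrite rpredBl ?dvdz1 ?gtn_eqF ?prime_gt1 //=.
  by rewrite dvdz_mull // dvd_p.
by rewrite -(Gauss_dvdzl _ cop) eqd dvdz_mulr.
Qed.

(** In the Smith basis [e *m Q = 0] becomes [e'_i * d_i = 0]: a nonzero entry of [e'] produces a
    zero invariant factor, while a nonzero d_i kills the rank-one correction in row [i] on the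
    diagonal and leaves d_i dividing [m]. *)
Lemma smith_corank1 (N : nat) (m : int) (L R T : 'M[int]_N) (d : seq int)
    (c : 'cV[int]_N) (e : 'rV[int]_N) :
    m != 0 -> e != 0 -> L \in unitmx -> R \in unitmx -> sorted dvdz d ->
    let Q := L *m smith_mx N d *m R in
    e *m Q = 0 -> Q *m T = m%:M - c *m e ->
  d`_N.-1 = 0 /\ (forall i, (i < N.-1)%N -> (d`_i %| m)%Z).
Proof.
move=> m_neq0 e_neq0 uL uR sd Q eQ QT.
pose e' := e *m L; pose c' := invmx L *m c.
have e'd i : e' 0 i * d`_i = 0.
  have : e' *m smith_mx N d = 0.
    by apply: (can_inj (mulmxK uR)); rewrite mul0mx -eQ /Q !mulmxA.
  by move=> /matrixP/(_ 0 i); rewrite mul_smith_mx [RHS]mxE.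
have eqD : smith_mx N d *m (R *m T *m L) = m%:M - c' *m e'.
  have uL' : invmx L \in unitmx by rewrite unitmx_inv.
  apply: (can_inj (mulKmx uL)).
  apply: (can_inj (mulmxK uL')).
  rewrite !mulmxA mulmxK // -/Q QT mulmxBr mulmxBl !mulmxA mulmxV // mul1mx.
  by rewrite mulmxK // mul_mx_scalar -scalemxAl mulmxV // scalemx1.
have eqDij (i j : 'I_N) :
    d`_i * (R *m T *m L) i j = m *+ (i == j) - c' i 0 * e' 0 j.
  move/matrixP/(_ i j): eqD; rewrite smith_mul_mx => ->.
  by rewrite mxE [m%:M i j]mxE [X in _ + X]mxE [(c' *m e') i j]mxE big_ord1.
have [l e'l] : exists l, e' 0 l != 0.
  have: e' != 0.
    apply: contra e_neq0 => /eqP e'0.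
    by rewrite -[e](mulmxK uL) -/e' e'0 mul0mx.
  by move=> /rV0Pn[l el]; exists l.
have dl : d`_l = 0 by have /eqP := e'd l; rewrite mulf_eq0 (negPf e'l) => /eqP.
have dlast : d`_N.-1 = 0.
  have lel : (l <= N.-1)%N by have := ltn_ord l; lia.
  by have := smith_dvd_leq sd lel; rewrite dl dvd0z => /eqP.
split=> // i lti.
have ltiN : (i < N)%N by lia.
have ltN : (N.-1 < N)%N by lia.
pose o := Ordinal ltiN; pose z := Ordinal ltN.
have oz : o != z by rewrite -val_eqE /= neq_ltn lti.
(* A second zero row would equate the scalar 2 by 2 block of [m] with a block of the rank-one
   [c' *m e']; the determinant then gives [m * m = 0]. *)
have [di0|di] := eqVneq d`_i 0.
  have Eoo := eqDij o o; have Eoz := eqDij o z.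
  have Ezz := eqDij z z.
  rewrite /= ?di0 ?dlast !mul0r ?(negPf oz) in Eoo Eoz Ezz.
  case/eqP: (mulf_neq0 m_neq0 m_neq0).
  have mo : m = c' o 0 * e' 0 o.
    by move/esym/eqP: Eoo; rewrite eqxx subr_eq0 => /eqP.
  have mz : m = c' z 0 * e' 0 z.
    by move/esym/eqP: Ezz; rewrite eqxx subr_eq0 => /eqP.
  rewrite {1}mo mz.
  rewrite mulrACA [e' 0 o * _]mulrC mulrACA.
  have -> : c' o 0 * e' 0 z = 0 by apply/eqP; rewrite -oppr_eq0 -sub0r -Eoz.
  by rewrite mul0r.
have e'i : e' 0 o = 0.
  by have /eqP := e'd o; rewrite mulf_eq0 (negPf di) orbF => /eqP.
have := eqDij o o; rewrite e'i mulr0 subr0 eqxx mulr1n => <-.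
by rewrite dvdz_mulr.
Qed.

Lemma torsion_coker_regular (N p q r s a b : nat) (Q X Y W Z T : 'M[int]_N)
    (c : 'cV[int]_N) (e : 'rV[int]_N) :
    (1 < a)%N -> (1 < b)%N -> coprime a b ->
    (r + p).+1 = N -> (s + q).+1 = N ->
    Q *m X *m Q = Q + a%:Z *: W -> Q *m Y *m Q = Q + b%:Z *: Z ->
    (forall k, prime k -> (k %| a)%N -> rank_mod k Q = r) ->
    (forall k, prime k -> (k %| b)%N -> rank_mod k Q = s) ->
    e != 0 -> e *m Q = 0 -> Q *m T = (a%:Z * b%:Z)%:M - c *m e ->
  zmod_isomorphic
    (torsion (coker (mulmx Q : {additive 'cV[int]_N -> 'cV[int]_N})))
    ('rV['Z_a]_p * 'rV['Z_b]_q)%type.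
Proof.
move=> a_gt1 b_gt1 cop_ab rpN sqN QXQ QYQ rka rkb e_neq0 eQ QT.
have a_gt0 : (0 < a)%N by lia.
have b_gt0 : (0 < b)%N by lia.
have [L uL [R uR [d sd defQ]]] := int_Smith_normal_form Q.
have ab_neq0 : a%:Z * b%:Z != 0 by rewrite mulf_neq0 ?eqz_nat -?lt0n.
have QE : Q = L *m smith_mx N d *m R by [].
rewrite QE in QXQ QYQ rka rkb eQ QT.
have [dlast dvab] := smith_corank1 ab_neq0 e_neq0 uL uR sd eQ QT.
apply: (torsion_coker_smith a_gt1 b_gt1 cop_ab rpN sqN uL uR defQ dlast).
move=> i y lti; have ltiN : (i < N)%N by lia.
have := smith_regular_mod a_gt0 uL uR sd QXQ rka ltiN.
have := smith_regular_mod b_gt0 uL uR sd QYQ rkb ltiN.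
have cab : coprimez a b by [].
(* The four cases are d_i equal, up to sign, to [a * b], [a], [b] and 1. *)
have := dvab i lti; case: (leqP r i) => ri; case: (leqP s i) => si dab db da /=.
- rewrite -Gauss_dvdz //; apply/idP/idP; apply: dvdz_trans => //.
  by rewrite Gauss_dvdz ?da.
- rewrite andbT; apply/idP/idP; apply: dvdz_trans => //.
  by rewrite -(Gauss_dvdzl _ db).
- apply/idP/idP; apply: dvdz_trans => //.
  by rewrite -(Gauss_dvdzr _ da).
- apply: dvdz_trans (dvd1z _); rewrite -(Gauss_dvdzr _ db) mulr1.
  by rewrite -(Gauss_dvdzr _ da).
Qed.

(** * The Laplacian of SZ(G, A, B) *)

Section VertexMatrices.
Variable V : finType.

(** Entries given on vertices allow block computations by case analysis on the vertex, away from
    ordinals. *)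
Definition vmx (f : V -> V -> int) : 'M[int]_#|V| :=
  \matrix_(i, j) f (enum_val i) (enum_val j).

Lemma eq_vmx f g : f =2 g -> vmx f = vmx g.
Proof. by move=> fg; apply/matrixP => i j; rewrite !mxE fg. Qed.

Lemma vmx_mul f g :
  vmx f *m vmx g = vmx (fun v w => \sum_u f v u * g u w).
Proof.
apply/matrixP => i j; rewrite !mxE.
transitivity (\sum_(u in V) f (enum_val i) u * g u (enum_val j)).
  by rewrite [RHS]big_enum_val; apply: eq_bigr => l _; rewrite !mxE.
exact: eq_bigl.
Qed.

Lemma vmxD f g : vmx f + vmx g = vmx (fun v w => f v w + g v w).
Proof. by apply/matrixP => i j; rewrite !mxE. Qed.

Lemma vmxZ (c : int) f : c *: vmx f = vmx (fun v w => c * f v w).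
Proof. by apply/matrixP => i j; rewrite !mxE. Qed.

Lemma vmx_tr f : (vmx f)^T = vmx (fun v w => f w v).
Proof. by apply/matrixP => i j; rewrite !mxE. Qed.

Lemma vmx_scalar (c : int) : vmx (fun v w => c *+ (v == w)) = c%:M.
Proof.
by apply/matrixP => i j; rewrite !mxE (inj_eq enum_val_inj).
Qed.

Lemma vmx_const (c : int) : vmx (fun _ _ => c) = const_mx c.
Proof. by apply/matrixP => i j; rewrite !mxE. Qed.

End VertexMatrices.

Section SzekeresMatrix.
Variables (lambda : nat) (G : finZmodType) (A B : {set G}).
Hypothesis lambda_gt0 : (0 < lambda)%N.
Hypothesis famAB : skew_hadamard_family lambda A B.

Local Notation V := (SZ_vertex G).
Local Notation ind X x := ((x \in X)%:R : int).
Local Notation dl g h := ((g == h)%:R : int).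
Local Notation va g := (Some (inl g) : V).
Local Notation vb g := (Some (inr g) : V).

Lemma sum_SZ_vertex (F : V -> int) :
  \sum_u F u = F None + (\sum_g F (va g) + \sum_g F (vb g)).
Proof.
rewrite (bigD1 None) //=; congr (_ + _).
rewrite (reindex_omap (Some : G + G -> V) id); last by case.
by rewrite big_sumType /=; congr (_ + _); apply: eq_bigl => g; rewrite eqxx.
Qed.

Lemma sum_dlr (F : G -> int) h : \sum_x F x * dl x h = F h.
Proof.
rewrite (bigD1 h) //= eqxx mulr1 big1 ?addr0 // => x /negPf ->.
by rewrite mulr0.
Qed.

Lemma sum_dll (F : G -> int) h : \sum_x dl h x * F x = F h.
Proof.
by rewrite -[RHS]sum_dlr; apply: eq_bigr => x _; rewrite mulrC eq_sym.
Qed.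

Lemma sum_dl (h : G) : \sum_x dl x h = 1.
Proof.
rewrite -[RHS](sum_dlr (fun=> 1) h).
by under [RHS]eq_bigr do rewrite mul1r.
Qed.

Lemma sum_dl_sym (g : G) : \sum_x dl g x = 1.
Proof. by under eq_bigr do rewrite eq_sym; rewrite sum_dl. Qed.

Lemma sum_shift (F : G -> int) g : \sum_x F (x - g) = \sum_x F x.
Proof.
by rewrite [RHS](reindex_inj (addIr (- g))).
Qed.

Lemma sum_refl (F : G -> int) g : \sum_x F (g - x) = \sum_x F x.
Proof.
rewrite [RHS](reindex_inj (inj_comp (addrI g) oppr_inj)).
by apply: eq_bigr.
Qed.

(** * Indicator functions and correlations of the two blocks *)

Lemma skew_ind (X : {set G}) x :
  skew_set X -> ind X x + ind X (- x) = 1 - dl x 0.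
Proof.
have negE : (x \in neg_set X) = (- x \in X).
  by rewrite -{1}[x]opprK mem_imset //; apply: oppr_inj.
case=> /setP/(_ x) capX /setP/(_ x); move: capX; rewrite inE negE !inE negE.
by case: (x \in X); case: (- x \in X); case: (x == 0).
Qed.

Lemma diff_countE (X : {set G}) g :
  (diff_count X g)%:Z = \sum_x ind X x * ind X (x - g).
Proof.
rewrite /diff_count -sum1_card big_mkcond /=.
rewrite -natz natr_sum.
transitivity (\sum_(p : G * G) ind X p.1 * ind X p.2 * dl p.2 (p.1 - g)).
  apply: eq_bigr => -[x y] _; rewrite !inE /=.
  rewrite subr_eq addrC -subr_eq eq_sym.
  by case: (x \in X); case: (y \in X); case: (y == _).
rewrite -(pair_bigA _ (fun x y => ind X x * ind X y * dl y (x - g))) /=.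
by apply: eq_bigr => x _; rewrite sum_dlr.
Qed.

Let skewA : skew_set A. Proof. by case: famAB. Qed.
Let skewB : skew_set B. Proof. by case: famAB. Qed.

Lemma card_group : #|G|%:Z = 2 * lambda%:Z + 1.
Proof. by case: famAB => -> _ _ _; lia. Qed.

Lemma sum_const (c : int) : \sum_(x : G) c = (2 * lambda%:Z + 1) * c.
Proof. by rewrite sumr_const -card_group -mulr_natl natz. Qed.

Lemma sum_skew_ind (X : {set G}) : skew_set X -> \sum_x ind X x = lambda%:Z.
Proof.
move=> sX; have : \sum_x ind X x + \sum_x ind X (0 - x) = 2 * lambda%:Z.
  rewrite -big_split /=.
  under eq_bigr do rewrite sub0r skew_ind //.
  rewrite sumrB sum_const sum_dl; lia.
rewrite (sum_refl (fun x => ind X x)).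
by move: (\sum_x _) => S; lia.
Qed.

(** Away from 0 this is the difference condition, where positivity of [lambda] makes the natural
    subtraction exact. At 0 it is the total size of the blocks, [2 * lambda]. *)
Lemma autocorr g :
  \sum_x ind A x * ind A (x - g) + \sum_x ind B x * ind B (x - g) =
  (lambda%:Z + 1) * dl g 0 + (lambda%:Z - 1).
Proof.
have [->|g0] := eqVneq g 0; last first.
  case: famAB => _ _ _ /(_ g g0) e.
  by rewrite -!diff_countE -PoszD e mulr0 add0r; lia.
have idm (X : {set G}) x : ind X x * ind X (x - 0) = ind X x.
  by rewrite subr0 -natrM mulnb andbb.
under eq_bigr do rewrite idm; under [X in _ + X]eq_bigr do rewrite idm.
rewrite !sum_skew_ind ?eqxx //; lia.
Qed.


Lemma sum_dlr_sym (F : G -> int) h : \sum_x F x * dl h x = F h.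
Proof. by rewrite -[RHS]sum_dlr; apply: eq_bigr => x _; rewrite eq_sym. Qed.

Lemma skew_pair (X : {set G}) g h :
  skew_set X -> ind X (h - g) + ind X (g - h) = 1 - dl g h.
Proof.
by move=> sX; rewrite -(opprB h) skew_ind // subr_eq0 [h == g]eq_sym.
Qed.

Lemma sum_ind_subr (X : {set G}) g :
  skew_set X -> \sum_x ind X (x - g) = lambda%:Z.
Proof. by move=> sX; rewrite (sum_shift (fun x => ind X x)) sum_skew_ind. Qed.

Lemma sum_ind_subl (X : {set G}) g :
  skew_set X -> \sum_x ind X (g - x) = lambda%:Z.
Proof. by move=> sX; rewrite (sum_refl (fun x => ind X x)) sum_skew_ind. Qed.

Lemma corr_subr (X : {set G}) g h :
  \sum_x ind X (x - g) * ind X (x - h) = \sum_x ind X x * ind X (x - (h - g)).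
Proof.
rewrite -(sum_shift (fun x => ind X x * ind X (x - (h - g))) g).
by apply: eq_bigr => x _; rewrite opprB addrA subrK.
Qed.

Lemma corr_subl (X : {set G}) g h :
  \sum_x ind X (g - x) * ind X (h - x) = \sum_x ind X (x - g) * ind X (x - h).
Proof.
rewrite corr_subr -(sum_refl (fun x => ind X x * ind X (x - (h - g))) h).
by apply: eq_bigr => x _; rewrite mulrC addrAC opprB addrCA subrr addr0.
Qed.

Lemma autocorr_pair g h :
  \sum_x ind A (x - g) * ind A (x - h) + \sum_x ind B (x - g) * ind B (x - h) =
  (lambda%:Z + 1) * dl g h + (lambda%:Z - 1).
Proof. by rewrite !corr_subr autocorr subr_eq0 eq_sym. Qed.

(** The reflection of [x] to [h + g - x] gives both sums the factor [ind A (x - g)]; skewness of [B]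
    collapses the remaining factors to [1 - dl h x]. *)
Lemma cross_corr g h :
  \sum_x ind A (x - g) * ind B (x - h) + \sum_x ind B (x - g) * ind A (h - x) =
  lambda%:Z - ind A (h - g).
Proof.
have -> : \sum_x ind B (x - g) * ind A (h - x) =
    \sum_x ind A (x - g) * ind B (h - x).
  rewrite -(sum_refl (fun x => ind A (x - g) * ind B (h - x)) (h + g)).
  apply: eq_bigr => x _; rewrite mulrC; congr (ind A _ * ind B _).
    by rewrite addrAC addrK.
  by rewrite opprB addrCA opprD addNKr.
rewrite -big_split /=.
under eq_bigr do rewrite -mulrDr skew_pair // mulrBr mulr1.
by rewrite sumrB sum_ind_subr // sum_dlr_sym.
Qed.

(** * The adjacency matrix by blocks and its regularity *)

Definition szM (v w : V) : int :=
  match v, w with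
  | None, Some (inl _) => 1
  | Some (inl g), Some (inl h) => ind A (h - g)
  | Some (inl g), Some (inr h) => ind B (h - g) + dl g h
  | Some (inr _), None => 1
  | Some (inr g), Some (inr h) => ind A (g - h)
  | Some (inr g), Some (inl h) => ind B (h - g)
  | _, _ => 0
  end.

(** Each block reduces to skewness; between the two copies of [G], the arcs from a_g to b_g fill the
    gap that skewness leaves at [g = h]. *)
Lemma szM_tournament v w : szM v w + szM w v = 1 - (v == w)%:R.
Proof.
have eqa g h : (va g == va h) = (g == h) by [].
have eqb g h : (vb g == vb h) = (g == h) by [].
case: v w => [[g|g]|] [[h|h]|] //=; rewrite ?eqa ?eqb ?addr0 ?add0r ?subr0 //.
- by rewrite skew_pair.
- by rewrite addrAC skew_pair // subrK.
- by rewrite addrA skew_pair // [h == g]eq_sym subrK.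
- by rewrite skew_pair // eq_sym.
Qed.

(** Double regularity: the blocks inside one copy of [G] come from [autocorr_pair], the mixed ones
    from [cross_corr]. *)
Lemma szM_gram v w :
  \sum_u szM v u * szM w u = (lambda%:Z + 1) * (v == w)%:R + lambda%:Z.
Proof.
have eqa g h : (va g == va h) = (g == h) by [].
have eqb g h : (vb g == vb h) = (g == h) by [].
case: v w => [[g|g]|] [[h|h]|]; rewrite sum_SZ_vertex /= ?eqa ?eqb.
- under [X in _ + (_ + X)]eq_bigr do rewrite mulrDl !mulrDr.
  rewrite !big_split /= sum_dlr_sym sum_dll sum_dll.
  have := autocorr_pair g h; have := skew_pair g h skewB.
  rewrite [h == g]eq_sym mulr0; move: (dl g h) (ind B _) (ind B _).
  move: (\sum_x _) (\sum_x _) => *; lia.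
- under [X in _ + (_ + X)]eq_bigr do rewrite mulrDl.
  rewrite big_split /= sum_dll; have := cross_corr g h.
  move: (\sum_x _) (\sum_x _) (ind A _) => *; lia.
- under eq_bigr do rewrite mulr1; rewrite sum_ind_subr //.
  under eq_bigr do rewrite mulr0; rewrite sum_const; lia.
- under [X in _ + (_ + X)]eq_bigr do rewrite mulrDr.
  rewrite big_split /= sum_dlr_sym; have := cross_corr h g.
  under eq_bigr do rewrite mulrC; under [X in _ + X]eq_bigr do rewrite mulrC.
  move: (\sum_x _) (\sum_x _) (ind A _) => *; lia.
- rewrite corr_subl; have := autocorr_pair g h.
  move: (\sum_x _) (\sum_x _) (dl g h) => *; lia.
- under eq_bigr do rewrite mulr1; rewrite sum_ind_subr //.
  under eq_bigr do rewrite mulr0; rewrite sum_const; lia.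
- under eq_bigr do rewrite mul1r; rewrite sum_ind_subr //.
  under eq_bigr do rewrite mul0r; rewrite sum_const; lia.
- under eq_bigr do rewrite mul1r; rewrite sum_ind_subr //.
  under eq_bigr do rewrite mul0r; rewrite sum_const; lia.
- by rewrite !sum_const; lia.
Qed.

Lemma szM_sum v : \sum_u szM v u = 2 * lambda%:Z + 1.
Proof.
case: v => [[g|g]|]; rewrite sum_SZ_vertex /=.
- by rewrite big_split /= !sum_ind_subr // sum_dl_sym; lia.
- by rewrite sum_ind_subr // sum_ind_subl //; lia.
- by rewrite !sum_const; lia.
Qed.

(* X and Y solve Q X + Y Q = 1 modulo 4 * lambda + 3 for the Laplacian Q, and E
   is the quotient of Q X + Y Q - 1 by 4 * lambda + 3. *)
Definition szX (v w : V) : int :=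
  match v, w with
  | Some (inl _), Some (inl _) => - 2%:Z
  | Some (inl g), Some (inr h) => dl g h
  | Some (inr _), None => 2%:Z
  | Some (inr g), Some (inl h) => 6%:Z - dl g h
  | _, _ => 0
  end.

Definition szY (v w : V) : int :=
  match v, w with
  | None, None => - 2%:Z
  | None, Some (inl _) => - 4%:Z
  | Some (inl _), None => - 3%:Z
  | Some (inl _), Some (inl _) => - 4%:Z
  | Some (inl g), Some (inr h) => dl g h
  | Some (inr _), None => 1
  | Some (inr g), Some (inl h) => - dl g h
  | _, _ => 0
  end.

Definition szE (v w : V) : int :=
  match v, w with
  | None, None => - 1
  | None, Some (inr _) => 1
  | Some (inl _), None => - 2%:Z
  | Some (inl _), Some (inl _) => - 3%:Z
  | Some (inl g), Some (inr h) => dl g h + 1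
  | Some (inr _), None => 1
  | Some (inr g), Some (inl h) => 2%:Z - dl g h
  | _, _ => 0
  end.

Lemma sum_mul0l (F : G -> int) : \sum_x 0 * F x = 0.
Proof. by rewrite big1 // => x _; rewrite mul0r. Qed.

Lemma szY_sum v :
  \sum_u szY v u =
    (4 * lambda%:Z + 3) * (if v is Some (inr _) then 0 else - 2%:Z).
Proof.
case: v => [[g|g]|]; rewrite sum_SZ_vertex /= ?sum_const.
- by rewrite sum_dl_sym; lia.
- by rewrite sumrN sum_dl_sym; lia.
- lia.
Qed.

(** This is Q X + Y Q = 1 + n E with [2 * lambda + 1 - szM] substituted for Q. As X and Y contain
    only constants and Kronecker deltas, each sum is a row or column sum or a single entry; the
    single entries of [B] cancel and those of [A] pair up by skewness. *)
Lemma szXY v w :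
  \sum_u szM v u * szX u w + \sum_u szY v u * szM u w =
  (2 * lambda%:Z + 1) * (szX v w + szY v w) - (v == w)%:R
    - (4 * lambda%:Z + 3) * szE v w.
Proof.
have eqa g h : (va g == va h) = (g == h) by [].
have eqb g h : (vb g == vb h) = (g == h) by [].
case: v w => [[g|g]|] [[h|h]|]; rewrite !sum_SZ_vertex /= ?eqa ?eqb.
- under [X in _ + (_ + X) + _]eq_bigr do rewrite mulrDl !mulrBr.
  rewrite !(big_split, sumrB, sumrN) /= -!mulr_suml -!mulr_sumr.
  rewrite ?sum_dlr ?sum_dll ?sum_dlr_sym sum_dl_sym !sum_ind_subr //.
  rewrite sum_ind_subl //.
  by move: (ind B _); case: (g == h) => *; lia.
- rewrite sum_dlr sum_dll -mulr_suml -mulr_sumr !big_split /= sum_dl mulr0.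
  rewrite sum_ind_subl //; have := skew_pair g h skewA.
  by move: (ind A _) (ind A _) (\sum_x _); case: (g == h) => *; lia.
- rewrite -!mulr_suml big_split /= sum_dl_sym sum_ind_subr // !mulr0.
  by rewrite sum_ind_subr //; lia.
- under [X in _ + (_ + X) + _]eq_bigr do rewrite mulrBr.
  under [X in _ + (_ + (X + _))]eq_bigr do rewrite mulNr.
  rewrite sumrN sumrB -!mulr_suml sum_dll sum_dlr.
  rewrite sum_ind_subr // sum_ind_subl //.
  rewrite sum_mul0l; have := skew_pair g h skewA.
  by move: (ind A _) (ind A _); case: (g == h) => *; lia.
- under [X in _ + (_ + (X + _))]eq_bigr do rewrite mulNr.
  rewrite sumrN -mulr_suml sum_dlr sum_dll sum_mul0l.
  by move: (ind B _) (\sum_x _); case: (g == h) => *; lia.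
- rewrite sum_mul0l -!mulr_suml sum_ind_subl //.
  by move: (\sum_x _) (\sum_x _) => *; lia.
- rewrite !sum_mul0l !sum_const -!mulr_sumr sum_ind_subl //; lia.
- rewrite !sum_mul0l -!mulr_sumr sum_dl big_split /= sum_dl.
  by rewrite sum_ind_subl //; lia.
- by rewrite !sum_mul0l; lia.
Qed.

(** Skewness keeps 0 out of [B], so adjoining it is a disjoint union and indicators add. *)
Lemma SZ_arcE v w : ((SZ_arc A B v w : nat)%:Z) = szM v w.
Proof.
have mem_translate (X : {set G}) g h :
    (h \in [set g + z | z in X]) = (h - g \in X).
  by rewrite -{1}[h](subrK g) addrC mem_imset //; apply: addrI.
have zeroB : 0 \notin B.
  by have := skew_ind 0 skewB; rewrite oppr0 eqxx; case: (0 \in B).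
have memN g : (g \in neg_set A) = (- g \in A).
  by rewrite -{1}[g]opprK mem_imset //; apply: oppr_inj.
case: v w => [[g|g]|] [[h|h]|] //=; rewrite ?mem_translate ?natz //.
- rewrite !inE subr_eq0 eq_sym; have [->|] := eqVneq g h.
    by rewrite subrr (negPf zeroB).
  by rewrite orbF addr0.
- by rewrite memN opprB.
Qed.

Lemma SZ_outdegree v : (outdegree (SZ_arc A B) v)%:Z = 2 * lambda%:Z + 1.
Proof.
rewrite -(szM_sum v) /outdegree -sum1_card big_mkcond -natz natr_sum /=.
by apply: eq_bigr => u _; rewrite inE -SZ_arcE; case: SZ_arc.
Qed.

Lemma SZ_laplacianE :
  laplacian (SZ_arc A B) = (2 * lambda%:Z + 1)%:M - vmx szM.
Proof.
apply/matrixP => i j; rewrite !mxE SZ_outdegree; congr (_ - _).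
exact: SZ_arcE.
Qed.

(** * Matrix identities for the Laplacian *)

Let k : int := 2 * lambda%:Z + 1.
Let n : int := 4 * lambda%:Z + 3.
Let M : 'M[int]_#|V| := vmx szM.
Let Q := laplacian (SZ_arc A B).
Let J : 'M[int]_#|V| := const_mx 1.

Lemma card_SZ_vertex : #|V| = (4 * lambda + 3)%N.
Proof.
by case: famAB => cG _ _ _; rewrite card_option card_sum cG; lia.
Qed.

Let Q_def : Q = k%:M - M.
Proof. exact: SZ_laplacianE. Qed.

Let MT : M^T = J - 1%:M - M.
Proof.
apply/matrixP => i j; rewrite !mxE.
have := szM_tournament (enum_val i) (enum_val j).
rewrite (inj_eq enum_val_inj) -(mulr1n (1 : int)).
by case: (i == j) => /= e; lia.
Qed.

Lemma laplacian_const : Q *m J = 0.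
Proof.
rewrite Q_def mulmxBl mul_scalar_mx; apply/eqP; rewrite subr_eq0; apply/eqP.
rewrite /M /J -vmx_const vmx_mul vmxZ; apply: eq_vmx => v w.
by under eq_bigr do rewrite mulr1; rewrite szM_sum mulr1.
Qed.

Lemma laplacianD_tr : Q + Q^T = n%:M - J.
Proof.
rewrite Q_def linearB /= tr_scalar_mx MT.
apply/matrixP => i j; rewrite !mxE; case: (i == j); rewrite /n /k /=; lia.
Qed.

Lemma laplacian_gram : Q *m Q^T = (lambda%:Z + 1) *: (n%:M - J).
Proof.
have MMT : M *m M^T = (lambda%:Z + 1)%:M + lambda%:Z *: J.
  rewrite /M vmx_tr vmx_mul -vmx_scalar /J -vmx_const vmxZ vmxD.
  apply: eq_vmx => v w; rewrite szM_gram mulr1; congr (_ + _).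
  by rewrite mulr_natr.
rewrite Q_def linearB /= tr_scalar_mx mulmxBl !mulmxBr MMT.
rewrite !mul_mx_scalar mul_scalar_mx MT.
move: M => M'; apply/matrixP => i j; rewrite !mxE.
by case: (i == j); rewrite /n /k /=; ring.
Qed.

(** Column sums follow from row sums by transposing: Q^T = n - J - Q, and n - J kills J since n is
    the number of vertices. *)
Lemma const_laplacian : J *m Q = 0.
Proof.
have JT : J^T = J by rewrite /J trmx_const.
have QT : Q^T = n%:M - J - Q by rewrite -laplacianD_tr addrAC subrr add0r.
apply: trmx_inj; rewrite trmx_mul JT trmx0 QT.
rewrite (mulmxBl (n%:M - J)) laplacian_const subr0 mulmxBl mul_scalar_mx.
apply/matrixP => i j; rewrite !mxE.
under eq_bigr do rewrite !mxE mulr1.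
by rewrite sumr_const card_ord card_SZ_vertex mulr1 /n; lia.
Qed.

Lemma laplacian_sq : Q *m Q = n *: Q - (lambda%:Z + 1) *: (n%:M - J).
Proof.
have {2}-> : Q = n%:M - J - Q^T by rewrite -laplacianD_tr addrK.
by rewrite !mulmxBr laplacian_const laplacian_gram subr0 mul_mx_scalar.
Qed.

Let X : 'M[int]_#|V| := vmx szX.
Let Y : 'M[int]_#|V| := vmx szY.
Let E : 'M[int]_#|V| := vmx szE.

Lemma laplacian_homotopy : Q *m X + Y *m Q = 1%:M + n *: E.
Proof.
rewrite Q_def mulmxBl mulmxBr mul_scalar_mx mul_mx_scalar addrACA -opprD.
rewrite -scalerDr /M /X /Y /E !vmx_mul -vmx_scalar !vmxD !vmxZ vmxD.
apply/matrixP => i j; rewrite !mxE szXY.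
by rewrite /k /n; case: (enum_val i == _) => /=; ring.
Qed.

Lemma laplacian_regular_n : exists W, Q *m X *m Q = Q + n *: W.
Proof.
have [F YJ] : exists F, Y *m J = n *: F.
  exists (vmx (fun v _ => if v is Some (inr _) then 0 else - 2%:Z)).
  rewrite /Y /J -vmx_const vmx_mul vmxZ; apply: eq_vmx => v w.
  by under eq_bigr do rewrite mulr1; rewrite szY_sum.
(* Read off from Q X Q = Q + n E Q - Y Q^2, expanding Q^2 and replacing Y J by n F. *)
exists (E *m Q - Y *m Q + (lambda%:Z + 1) *: (Y - F)).
have -> : Q *m X = 1%:M + n *: E - Y *m Q by rewrite -laplacian_homotopy addrK.
rewrite mulmxBl mulmxDl mul1mx -mulmxA laplacian_sq (mulmxBr Y (n *: Q)).
rewrite -!scalemxAr (mulmxBr Y n%:M) YJ mul_mx_scalar -scalemxAl.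
move: (E *m Q) (Y *m Q) => EQ YQ.
apply/matrixP => i j; rewrite !mxE; ring.
Qed.

(** Expand - Q^2 and use - n = 1 - 4 (lambda + 1). *)
Lemma laplacian_regular_lambda :
  Q *m (- 1%:M) *m Q = Q + (lambda + 1)%N%:Z *: (n%:M - J - 4%:Z *: Q).
Proof.
rewrite mulmxN mulmx1 mulNmx laplacian_sq PoszD.
by apply/matrixP => i j; rewrite !mxE /n; ring.
Qed.

(** * Ranks modulo the prime divisors of [lambda + 1] and of [4 * lambda + 3] *)

Section RankModPrime.
Variable p : nat.
Hypothesis p_pr : prime p.

Let f : {rmorphism int -> 'F_p} := intr.
Let q := map_mx f Q.

Let f_eq0 z : (p %| z)%Z -> f z = 0.
Proof. by rewrite (dvdz_pcharf (pchar_Fp p_pr)) => /eqP. Qed.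

Let rank_const : (\rank (map_mx f J) <= 1)%N.
Proof.
have -> : map_mx f J = (const_mx 1 : 'cV_ _) *m (const_mx 1 : 'rV_ _).
  by apply/matrixP => i l; rewrite !mxE big_ord1 !mxE rmorph1 mulr1.
exact: mulmx_max_rank.
Qed.

Lemma rank_mod_laplacian_lambda :
  (p %| lambda + 1)%N -> rank_mod p Q = (2 * lambda + 1)%N.
Proof.
move=> p_dv; rewrite /rank_mod -/f -/q.
have fl : f (lambda%:Z + 1) = 0 by apply: f_eq0; rewrite -PoszD.
(* Sylvester's rank inequality for the zero product of [q] and its transpose. *)
have ub : (\rank q + \rank q^T - #|V| <= 0)%N.
  apply: leq_trans (mxrank_mul_min _ _) _.
  by rewrite map_trmx -map_mxM laplacian_gram map_mxZ fl scale0r mxrank0.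
have lb : (#|V| <= \rank q + \rank q^T + 1)%N.
  have fn : f n = - 1.
    have -> : n = 4 * (lambda%:Z + 1) - 1 by rewrite /n; ring.
    by rewrite rmorphB rmorphM fl mulr0 rmorph1 sub0r.
  have e1 : q + q^T + map_mx f J = (- 1)%:M.
    by rewrite map_trmx -!map_mxD laplacianD_tr subrK map_scalar_mx fn.
  have u1 : (- 1)%:M \in @unitmx 'F_p #|V|.
    by rewrite unitmxE det_scalar unitrX ?unitrN1.
  rewrite -{1}(mxrank_unit u1) -e1.
  apply: leq_trans (mxrank_add _ _) _.
  by rewrite leq_add ?mxrank_add.
(* Twice the rank is [#|V|] or [#|V| - 1], and [#|V|] is odd. *)
move: card_SZ_vertex ub lb; rewrite mxrank_tr; move: (\rank q) => r; lia.
Qed.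

Lemma rank_mod_laplacian_n :
  (p %| 4 * lambda + 3)%N -> rank_mod p Q = (2 * lambda + 2)%N.
Proof.
move=> p_dv; rewrite /rank_mod -/f -/q.
have fn : f n = 0 by apply: f_eq0; rewrite /n -PoszM -PoszD.
have ub : (\rank q + \rank q - #|V| <= 1)%N.
  apply: leq_trans (mxrank_mul_min _ _) _.
  rewrite -map_mxM laplacian_sq map_mxB map_mxZ fn scale0r sub0r.
  rewrite map_mxZ map_mxB map_scalar_mx fn raddf0 sub0r scalerN opprK.
  exact: leq_trans (mxrank_scale _ _) rank_const.
have lb : (#|V| <= \rank q + \rank q)%N.
  rewrite -{1}(@mxrank1 'F_p #|V|).
  have <- : q *m map_mx f X + map_mx f Y *m q = 1%:M.
    by rewrite -!map_mxM -map_mxD laplacian_homotopy map_mxD map_mxZ fn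
      scale0r addr0 map_mx1.
  apply: leq_trans (mxrank_add _ _) _.
  by rewrite leq_add ?mxrankM_maxl ?mxrankM_maxr.
(* Here twice the rank is [#|V|] or [#|V| + 1], and parity decides again. *)
move: card_SZ_vertex ub lb; move: (\rank q) => r; lia.
Qed.

End RankModPrime.

(** * The critical group *)

Lemma critical_group_SZ :
  zmod_isomorphic (critical_group (SZ_arc A B))
    ('rV['Z_(lambda + 1)]_(2 * lambda + 1) *
     'rV['Z_(4 * lambda + 3)]_(2 * lambda))%type.
Proof.
have [W regn] := laplacian_regular_n.
have cV := card_SZ_vertex.
(* The Gram identity supplies [T] as the transpose of [Q], and [c *m e] is [(lambda + 1) *: J]
   written as a column times the all-ones row. *)
apply: (@torsion_coker_regular #|V| _ _ (2 * lambda + 1) (2 * lambda + 2) _ _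
  Q (- 1%:M) X (n%:M - J - 4%:Z *: Q) W Q^T
  ((lambda%:Z + 1) *: const_mx 1) (const_mx 1)).
- lia.
- lia.
- have -> : (4 * lambda + 3 = 3 * (lambda + 1) + lambda)%N by lia.
  by rewrite /coprime gcdnMDl addn1 -/(coprime _ _) coprimeSn.
- lia.
- lia.
- exact: laplacian_regular_lambda.
- by rewrite regn /n -PoszM -PoszD.
- exact: rank_mod_laplacian_lambda.
- exact: rank_mod_laplacian_n.
- apply/eqP => /rowP/(_ (enum_rank None)); rewrite !mxE; lia.
- apply/rowP => j; have /matrixP/(_ (enum_rank None) j) := const_laplacian.
  rewrite mxE [RHS]mxE => JQ0; rewrite mxE [RHS]mxE -[RHS]JQ0.
  by apply: eq_bigr => i _; congr (_ * _); rewrite !mxE.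
rewrite laplacian_gram.
apply/matrixP => i j; rewrite !mxE big_ord1 !mxE.
by case: (i == j); rewrite /n ?PoszD ?PoszM /=; ring.
Qed.

End SzekeresMatrix.

Theorem theorem2p2 (lambda : nat) (lambda_gt0 : (0 < lambda)%N)
    (G : finZmodType) (cardG : #|G| = (2 * lambda + 1)%N) (A B : {set G})
    (famAB : skew_hadamard_family lambda A B) :
  let Q := laplacian (SZ_arc A B) in
  [/\ zmod_isomorphic (critical_group (SZ_arc A B))
        ('rV['Z_(lambda + 1)]_(2 * lambda + 1) *
         'rV['Z_(4 * lambda + 3)]_(2 * lambda))%type,
      forall p : nat, prime p -> (p %| lambda + 1)%N ->
        rank_mod p Q = (2 * lambda + 1)%N
    & forall p : nat, prime p -> (p %| 4 * lambda + 3)%N ->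
        rank_mod p Q = (2 * lambda + 2)%N].
Proof.
split=> [|p p_pr p_dv|p p_pr p_dv].
- exact: critical_group_SZ.
- exact: rank_mod_laplacian_lambda.
- exact: rank_mod_laplacian_n.
Qed.
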